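(* Let $G$ be a connected graph with chromatic number $\chi(G)=3$. Then $G$ realizes the infinite sequence $(2,1^\infty)=(2,1,1,1,\dots)$ if and only if $G$ is (up to isomorphism) neither the $5$-cycle $C_5$ nor $T_{r,s,t}$ for any nonnegative integers $r,s,t$.
   Context: Graphs are finite and simple. For nonnegative integers $r,s,t$, $T_{r,s,t}$ denotes the graph obtained from a triangle $K_3$ by attaching $r$, $s$ and $t$ leaves (degree-one vertices) to its three vertices, respectively. Given a proper coloring of $G$, a vertex $v$ is a color-dominating vertex (CDV) if its closed neighborhood $N[v]$ contains all colors used in the coloring. A b-coloring is a proper coloring in which every color class contains at least one CDV. $G$ realizes a finite non-increasing sequence $(s_1,\dots,s_k)$ of positive integers, $k\ge1$, if $G$ has a b-coloring with exactly $k$ colors in which, for each $i\in\{1,\dots,k\}$, the $i$th color class contains at least $s_i$ CDVs. $G$ realizes an infinite sequence $(s_1,s_2,\dots)$ if it realizes $(s_1,\dots,s_k)$ for at least one integer $k\ge 1$. *)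

(* Defs.v *)
From mathcomp Require Import all_boot.

Set Implicit Arguments.
Unset Strict Implicit.
Unset Printing Implicit Defensive.

Record sgraph := SGraph {
  vertex :> finType;
  adj : rel vertex;
  adj_sym : symmetric adj;
  adj_irrefl : irreflexive adj }.

Arguments adj {s}.

Definition isomorphic (G H : sgraph) : Prop :=
  exists f : G -> H, bijective f /\ {mono f : x y / adj x y}.

Definition connected (G : sgraph) : Prop :=
  0 < #|G| /\ forall x y : G, connect adj x y.

Definition proper_coloring (G : sgraph) k (c : {ffun G -> 'I_k}) : bool :=
  [forall x, forall y, adj x y ==> (c x != c y)].

Definition colorable (G : sgraph) k : bool :=
  [exists c : {ffun G -> 'I_k}, proper_coloring c].

Lemma colorable_exists (G : sgraph) : exists k, colorable G k.
Proof.
exists #|G|; apply/existsP; exists [ffun x => enum_rank x].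
apply/forallP=> x; apply/forallP=> y; apply/implyP=> xy.
rewrite !ffunE (inj_eq enum_rank_inj).
by apply: contraTneq xy => ->; rewrite adj_irrefl.
Qed.

Definition chromatic_number (G : sgraph) : nat := ex_minn (colorable_exists G).

Definition closed_nbh (G : sgraph) (v : G) : {set G} :=
  [set w | (w == v) || adj v w].

Definition cdv (G : sgraph) k (c : {ffun G -> 'I_k}) (v : G) : bool :=
  [set c u | u : G] \subset [set c w | w in closed_nbh v].

Definition cdvs (G : sgraph) k (c : {ffun G -> 'I_k}) (i : 'I_k) : {set G} :=
  [set v | (c v == i) && cdv c v].

(* The second conjunct makes [c] surjective, so exactly [k] colors are used. *)
Definition b_coloring (G : sgraph) k (c : {ffun G -> 'I_k}) : bool :=
  proper_coloring c && [forall i, 0 < #|cdvs c i|].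

Definition realizes (G : sgraph) (s : seq nat) : Prop :=
  exists c : {ffun G -> 'I_(size s)},
    b_coloring c /\ forall i : 'I_(size s), nth 0 s i <= #|cdvs c i|.

(* Infinite sequences are indexed from 0. *)
Definition realizes_inf (G : sgraph) (s : nat -> nat) : Prop :=
  exists2 k, 0 < k & realizes G (mkseq s k).

Definition two_ones (i : nat) : nat := if i is 0 then 2 else 1.

Definition C5_adj : rel 'I_5 :=
  [rel i j : 'I_5 | (j == i.+1 %% 5 :> nat) || (i == j.+1 %% 5 :> nat)].

Fact C5_sym : symmetric C5_adj.
Proof. by move=> i j; apply: orbC. Qed.

Fact C5_irrefl : irreflexive C5_adj.
Proof. by case=> [[|[|[|[|[|]]]]]]. Qed.

Definition C5 : sgraph := SGraph C5_sym C5_irrefl.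

(* [inl i] is a triangle vertex; [inr (Tagged _ j)] with tag [i] is the [j]-th
   leaf attached to the triangle vertex [i]. *)
Definition T_vertex (r s t : nat) : finType :=
  ('I_3 + {i : 'I_3 & 'I_(tnth [tuple r; s; t] i)})%type.

Definition T_adj (r s t : nat) : rel (T_vertex r s t) := fun x y =>
  match x, y with
  | inl i, inl j => i != j
  | inl i, inr l => i == tag l
  | inr l, inl i => i == tag l
  | inr _, inr _ => false
  end.

Fact T_sym r s t : symmetric (@T_adj r s t).
Proof. by move=> [i|l] [j|m] //=; rewrite eq_sym. Qed.

Fact T_irrefl r s t : irreflexive (@T_adj r s t).
Proof. by move=> [i|l] //=; rewrite eqxx. Qed.

Definition Tgraph (r s t : nat) : sgraph := SGraph (@T_sym r s t) (@T_irrefl r s t).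

(* Main.v *)
Require Import Defs.
From mathcomp Require Import all_boot all_fingroup.

(** Vertices of a color class that are not CDVs can be recolored, so every class
of a 3-coloring contains a CDV, and it suffices to find a 3-coloring with two
CDVs of one color.  If there is none, each CDV [a] of a 3-coloring is alone in
its class for some 3-coloring; exactly two neighbors [b], [c] of [a] are not
leaves, and they are CDVs again.  If [b] and [c] are adjacent, the same fact at
[b] and [c] makes the graph a triangle with leaves.  Otherwise [b] and [c] have
further non-leaf neighbors [b'] and [c'], and the uniqueness of CDVs forces
[b'] to have no neighbors but [b] and [c']; repeating this from [b'] and [c']
closes the cycle [a b b' c' c].

Conversely, in a triangle with leaves only the three triangle vertices can be
CDVs, and in [C5] two CDVs of the same color would have a common neighbor, and
their other two neighbors, which are adjacent, would both get its color. *)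

Set Implicit Arguments.
Unset Strict Implicit.
Unset Printing Implicit Defensive.

(** * Adjacency, proper colorings and CDVs in propositional form *)

Lemma adjC (G : sgraph) (x y : G) : adj x y = adj y x.
Proof. exact: adj_sym. Qed.

Lemma adjNeq (G : sgraph) (x y : G) : adj x y -> x != y.
Proof. by apply: contraTneq => ->; rewrite adj_irrefl. Qed.

Lemma properP (G : sgraph) k (c : {ffun G -> 'I_k}) :
  reflect (forall x y, adj x y -> c x != c y) (proper_coloring c).
Proof.
by apply: (iffP forallP) => H x => [y /(implyP (forallP (H x) y)) //|];
   apply/forallP => y; apply/implyP/H.
Qed.

Lemma cdvP (G : sgraph) k (c : {ffun G -> 'I_k}) (v : G) :
  reflect (forall u, exists2 w, (w == v) || adj v w & c w = c u) (cdv c v).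
Proof.
apply: (iffP subsetP) => H => [u|i /imsetP[u _ ->]].
  have /imsetP[w] := H _ (imset_f c (isT : u \in G)).
  by rewrite inE => wv ->; exists w.
by have [w wv <-] := H u; apply: imset_f; rewrite inE.
Qed.

Lemma colorableP (G : sgraph) k :
  reflect (exists c : {ffun G -> 'I_k}, proper_coloring c) (colorable G k).
Proof. exact: existsP. Qed.

Lemma chromatic_le (G : sgraph) k : colorable G k -> chromatic_number G <= k.
Proof. by rewrite /chromatic_number; case: ex_minnP => m _; apply. Qed.

(** * Recoloring and permuting color classes *)

(** A vertex that is not a CDV misses a color on its closed neighborhood and can move to it. All
    such vertices of a class can move at once, since the class is independent. *)
Lemma recolor_class (G : sgraph) k (c : {ffun G -> 'I_k}) (i : 'I_k) :
    proper_coloring c ->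
  exists d : {ffun G -> 'I_k},
    [/\ proper_coloring d,
        forall v, (d v == i) = (c v == i) && cdv c v &
        forall v, c v != i -> d v = c v].
Proof.
move=> /properP cP.
pose missing v := [set c u | u : G] :\: [set c w | w in closed_nbh v].
(* The default [i] is never taken: a vertex that is not a CDV misses some color. *)
pose d := [ffun v => if (c v == i) && ~~ cdv c v
                     then odflt i [pick j in missing v] else c v].
have dN v : c v != i -> d v = c v by rewrite ffunE => /negbTE->.
have dR v : c v = i -> ~~ cdv c v ->
    d v != i /\ forall w, adj v w -> d v != c w.
  move=> cv ncdv; rewrite ffunE cv eqxx ncdv /=.
  case: pickP => [j|none]; last first.
    case/negP: ncdv; rewrite /cdv -setD_eq0; apply/eqP/setP=> j.
    by rewrite in_set0; apply: none.
  rewrite in_setD => /andP[/imsetP jN _] /=.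
  split=> [|w vw]; apply/eqP=> jE; apply: jN.
    by exists v; rewrite ?inE ?eqxx ?cv.
  by exists w; rewrite ?inE ?vw ?orbT.
exists d; split=> // [|v].
  (* An edge has at most one end in class [i], so by symmetry its end [y] may be taken outside. *)
  have half x y : adj x y -> c y != i -> d x != d y.
    move=> xy cy; rewrite (dN y cy).
    have [cx|cx] := eqVneq (c x) i; last by rewrite dN ?cP.
    have [ux|nx] := boolP (cdv c x); last by case: (dR x cx nx) => _; apply.
    by rewrite ffunE ux andbF cP.
  apply/properP=> x y xy; have [cy|cy] := eqVneq (c y) i; last exact: half.
  rewrite eq_sym half //; first by rewrite adjC.
  by rewrite -cy cP.
have [cv|cv] := eqVneq (c v) i; last by rewrite dN ?(negbTE cv).
have [uv|nv] := boolP (cdv c v); first by rewrite ffunE uv andbF cv eqxx.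
by apply/negbTE; case: (dR v cv nv).
Qed.

(** Without a CDV the class could be emptied by recoloring, leaving a proper coloring with one color
    fewer. *)
Lemma chromatic_class_cdv (G : sgraph) k (c : {ffun G -> 'I_k.+1})
    (i : 'I_k.+1) :
  chromatic_number G = k.+1 -> proper_coloring c ->
  exists2 v, c v = i & cdv c v.
Proof.
move=> chi cP; have [d [/properP dP di _]] := recolor_class i cP.
have [v /andP[/eqP]|none] := pickP (fun v => (c v == i) && cdv c v).
  by exists v.
have dNi v : i != d v by rewrite eq_sym di none.
pose e := [ffun v => s2val (unlift_some (dNi v))].
have eE v : d v = lift i (e v) by rewrite ffunE; case: unlift_some.
suff: colorable G k by move/chromatic_le; rewrite chi ltnn.
apply/colorableP; exists e; apply/properP=> x y /dP.
by rewrite !eE (inj_eq lift_inj).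
Qed.

(** Only the first term exceeds 1, and a transposition of colors puts the class with two CDVs
    first. *)
Lemma realizes_two_ones (G : sgraph) :
  realizes_inf G two_ones <->
  exists k (c : {ffun G -> 'I_k}) u v,
    [/\ b_coloring c, u != v, c u = c v, cdv c u & cdv c v].
Proof.
split=> [[k k_gt0 [c [cb cs]]]|[k [c [u [v [cb uv cuv cu cv]]]]]].
  have i0_lt : 0 < size (mkseq two_ones k) by rewrite size_mkseq.
  have := cs (Ordinal i0_lt); rewrite nth_mkseq //= => /card_gt1P[u [v []]].
  rewrite !inE => /andP[/eqP cu uc] /andP[/eqP cv vc] uv.
  by exists (size (mkseq two_ones k)), c, u, v; rewrite cu cv.
have k_gt0 : 0 < k by case: k c {cb cuv cu cv} => // c; case: (c u).
exists k => //; rewrite /realizes size_mkseq.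
pose s := tperm (c u) (Ordinal k_gt0).
pose d := [ffun x => s (c x)].
have dcdv x : cdv d x = cdv c x.
  apply/cdvP/cdvP=> H y; have [w wx /eqP cw] := H y; exists w => //; apply/eqP.
    by move: cw; rewrite !ffunE (inj_eq perm_inj).
  by rewrite !ffunE (inj_eq perm_inj).
have dcdvs i : cdvs d i = cdvs c (s i).
  apply/setP=> x; rewrite !inE dcdv ffunE -(inj_eq (@perm_inj _ s)).
  by rewrite tpermK.
case/andP: cb => /properP cP /forallP cs.
exists d; split=> [|i].
  apply/andP; split; last by apply/forallP=> i; rewrite dcdvs; apply: cs.
  by apply/properP=> x y xy; rewrite !ffunE (inj_eq perm_inj) cP.
rewrite nth_mkseq ?ltn_ord // dcdvs; case: i => [[|i] lti] //=.
apply/card_gt1P; exists u, v; rewrite !inE cu cv -cuv !andbT.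
have s0 (lt0 : 0 < k) : c u == s (Ordinal lt0).
  by rewrite (bool_irrelevance lt0 k_gt0) [s _]tpermR.
by split=> //; apply: s0.
Qed.

(** * Recognizing triangles with leaves and the 5-cycle *)

Lemma connected_closed (G : sgraph) (P : pred G) (a : G) :
    connected G -> P a -> (forall x y, adj x y -> P x -> P y) ->
  forall x, P x.
Proof.
move=> [_ Gc] Pa PS x.
have clP : closed adj P.
  by move=> y z yz; apply/idP/idP; apply: PS; rewrite // adjC.
by have := closed_connect clP (Gc a x); rewrite [a \in P]Pa => /esym.
Qed.

Lemma isomorphic_from (G H : sgraph) (f : H -> G) :
    injective f -> (forall y, y \in codom f) -> {mono f : x y / adj x y} ->
  isomorphic G H.
Proof.
move=> f_inj f_surj f_mono; exists (fun y => iinv (f_surj y)).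
have fK y : f (iinv (f_surj y)) = y by rewrite f_iinv.
split=> [|x y]; last by rewrite -f_mono !fK.
by exists f => // x; apply: f_inj; rewrite fK.
Qed.

Lemma Tgraph_char (G : sgraph) (t : 'I_3 -> G) :
    connected G -> (forall i j, i != j -> adj (t i) (t j)) ->
    (forall i x y, adj (t i) x -> x \notin codom t -> adj x y -> y = t i) ->
  exists p q r, isomorphic G (Tgraph p q r).
Proof.
move=> Gc tK tL.
have t_inj : injective t.
  by move=> i j tij; apply: contraTeq isT => /tK; rewrite tij adj_irrefl.
(* [L i] lists the leaves at [t i]; a leaf of [Tgraph] goes to the entry at its index. *)
pose L i := enum [pred x | adj (t i) x & x \notin codom t].
pose p := size (L ord0); pose q := size (L (inord 1)).
pose r := size (L (inord 2)).
have Lsize i : tnth [tuple p; q; r] i = size (L i).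
  case: i => [[|[|[|]]] lti] //; rewrite (tnth_nth 0) /=; congr (size (L _));
  by apply: val_inj; rewrite /= ?inordK.
pose f (x : Tgraph p q r) : G := match x with
  | inl i => t i
  | inr l => nth (t ord0) (L (tag l)) (tagged l)
  end.
have fL l : (adj (t (tag l)) (f (inr l))) && (f (inr l) \notin codom t).
  have: f (inr l) \in L (tag l) by rewrite mem_nth // -Lsize ltn_ord.
  by rewrite mem_enum.
have tLf i l : adj (t i) (f (inr l)) = (i == tag l).
  have /andP[al nl] := fL l.
  apply/idP/eqP=> [il|-> //]; apply: t_inj.
  by apply: (tL _ _ _ al nl); rewrite adjC.
exists p, q, r; apply: (@isomorphic_from G (Tgraph p q r) f).
- move=> [i|l] [j|m].
  + by move/t_inj->.
  + by move=> fE; case/andP: (fL m) => _ /negP[]; rewrite -fE; apply: codom_f.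
  + by move=> fE; case/andP: (fL l) => _ /negP[]; rewrite fE; apply: codom_f.
  + move=> fE; have/eqP lm: tag l == tag m.
      by rewrite -tLf -fE; case/andP: (fL l).
    case: l m lm fE => [i l] [j m] /= ij; case: j / ij in m *.
    move/eqP; rewrite nth_uniq ?enum_uniq -?Lsize ?ltn_ord // => /eqP lm.
    by congr (inr (Tagged _ _)); apply: val_inj.
(* Surjectivity: the image contains [t ord0] and is closed under adjacency. *)
- apply: (@connected_closed _ (mem (codom f)) (t ord0)) => //.
    by apply/codomP; exists (inl ord0).
  move=> x y xy /codomP[[i|l] xE]; last first.
    have /andP[al nl] := fL l.
    apply/codomP; exists (inl (tag l)) => /=.
    by apply: (tL _ _ _ al nl); rewrite -xE.
  have [/codomP[j ->]|ny] := boolP (y \in codom t).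
    by apply/codomP; exists (inl j).
  have yL : y \in L i by rewrite mem_enum inE -[t i]xE xy.
  have ltL : index y (L i) < tnth [tuple p; q; r] i by rewrite Lsize index_mem.
  apply/codomP.
  exists (inr (Tagged (fun i => 'I_(tnth [tuple p; q; r] i)) (Ordinal ltL))).
  by rewrite /= nth_index.
- move=> [i|l] [j|m] //=.
  + by have [->|/tK] := eqVneq i j; rewrite ?adj_irrefl.
  + exact: (tLf i m).
  + by rewrite adjC (tLf j l) eq_sym.
  + have /andP[al nl] := fL l; apply/negbTE/negP=> lm.
    have fE := tL _ _ _ al nl lm.
    by case/andP: (fL m) => _ /negP[]; rewrite /= fE; apply: codom_f.
Qed.

Lemma C5_char (G : sgraph) (a b b' c' c : G) :
    connected G -> uniq [:: a; b; b'; c'; c] ->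
    adj a =1 pred2 b c -> adj b =1 pred2 a b' -> adj b' =1 pred2 b c' ->
    adj c' =1 pred2 b' c -> adj c =1 pred2 c' a ->
  isomorphic G C5.
Proof.
move=> Gc abc Na Nb Nb' Nc' Nc.
pose f (i : C5) := tnth [tuple a; b; b'; c'; c] i.
have f_inj : injective f.
  by move=> i j /eqP; rewrite /f !(tnth_nth a) nth_uniq // => /eqP/val_inj.
have f_cod i : f i \in codom f by apply: codom_f.
apply: (isomorphic_from f_inj).
  have inf x : x \in [:: a; b; b'; c'; c] -> x \in codom f.
    by case/(@tnthP 5 _ [tuple a; b; b'; c'; c]) => i ->; apply: f_cod.
  apply: (@connected_closed _ (mem (codom f)) a) => //.
    by apply: inf; rewrite inE eqxx.
  move=> x y xy /codomP[i xE]; apply: inf; move: xy; rewrite xE /f.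
  case: i {xE} => [[|[|[|[|[|//]]]]] ?];
  rewrite (tnth_nth a) /= ?(Na, Nb, Nb', Nc, Nc');
  by case/orP=> /eqP->; rewrite !inE eqxx ?orbT.
have fE (i j : C5) : (f i == f j) = (i == j) by rewrite inj_eq.
pose o k (lt : k < 5) : C5 := Ordinal lt.
(* With the named vertices written as values of [f], adjacency reduces to equality of indices. *)
have [aE bE b'E c'E cE] : [/\ a = f (o 0 isT), b = f (o 1 isT),
    b' = f (o 2 isT), c' = f (o 3 isT) & c = f (o 4 isT)].
  by rewrite /f !(tnth_nth a).
move=> i j; rewrite [RHS]/=.
case: i => [[|[|[|[|[|//]]]]] ?];
rewrite {1}/f (tnth_nth a) /= ?(Na, Nb, Nb', Nc, Nc') /=;
rewrite ?{1}aE ?{1}bE ?{1}b'E ?{1}c'E ?{1}cE !fE;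
by case: j => [[|[|[|[|[|//]]]]] ?].
Qed.

(** * CDVs in colorings with three colors *)

Lemma ord3_cover (i j k l : 'I_3) :
  i != j -> i != k -> j != k -> [|| l == i, l == j | l == k].
Proof.
by case: i j k l => [[|[|[|//]]] ?] [[|[|[|//]]] ?] [[|[|[|//]]] ?]
  [[|[|[|//]]] ?].
Qed.

Lemma cdv_of_nbrs (G : sgraph) (c : {ffun G -> 'I_3}) (v x y : G) :
    adj v x -> adj v y -> c v != c x -> c v != c y -> c x != c y -> cdv c v.
Proof.
move=> vx vy cvx cvy cxy; apply/cdvP=> u.
case/or3P: (ord3_cover (c u) cvx cvy cxy) => /eqP->.
- by exists v; rewrite ?eqxx.
- by exists x; rewrite ?vx ?orbT.
- by exists y; rewrite ?vy ?orbT.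
Qed.

(** As the chromatic number is 3, color [i] is in use, so a CDV must see it. *)
Lemma cdv_nbr (G : sgraph) (c : {ffun G -> 'I_3}) (v : G) (i : 'I_3) :
    chromatic_number G = 3 -> proper_coloring c -> cdv c v -> i != c v ->
  exists2 w, adj v w & c w = i.
Proof.
move=> chi cP /cdvP cv iv; have [u cu _] := chromatic_class_cdv i chi cP.
have [w /predU1P[->|vw] cw] := cv u; last by exists w; rewrite ?cw.
by move: iv; rewrite -cu -cw eqxx.
Qed.

Definition nonleaf_nbr (G : sgraph) (a : G) : pred G :=
  [pred x | adj a x && [exists y, adj x y && (y != a)]].

Lemma nonleaf_nbrI (G : sgraph) (a x y : G) :
  adj a x -> adj x y -> y != a -> nonleaf_nbr a x.
Proof.
by move=> ax xy ya; apply/andP; split=> //; apply/existsP; exists y; rewrite xy.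
Qed.

(** * Graphs whose 3-colorings have at most one CDV per color *)

Section OneCdvPerClass.

Variable G : sgraph.
Hypothesis chi3 : chromatic_number G = 3.
Hypothesis cdv_uniq : forall (c : {ffun G -> 'I_3}) (u v : G),
  proper_coloring c -> cdv c u -> cdv c v -> c u = c v -> u = v.

(** The coloring is left open, so that criticality can pass from vertex to vertex while the coloring
    changes. *)
Definition critical (a : G) : Prop :=
  exists2 c : {ffun G -> 'I_3}, proper_coloring c & cdv c a.

Lemma critical_exists : exists a, critical a.
Proof.
have /colorableP[c cP] : colorable G 3.
  by rewrite -chi3 /chromatic_number; case: ex_minnP.
by have [a _ ca] := chromatic_class_cdv ord0 chi3 cP; exists a, c.
Qed.

(* Recolouring the class of [a] leaves [a] alone in it; the CDVs of the other
   two classes of the new colouring then have to be neighbours of [a], and any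
   non-leaf neighbour of [a] is such a CDV. *)
Lemma critical_pivot (a : G) : critical a ->
  exists (g : {ffun G -> 'I_3}) b c,
    [/\ proper_coloring g, forall v, g v = g a -> v = a, g b != g c,
        critical b /\ critical c & nonleaf_nbr a =1 pred2 b c].
Proof.
move=> [f fP fa]; have [g [gP gi _]] := recolor_class (f a) fP.
have ga : g a = f a by apply/eqP; rewrite gi eqxx.
(* The class of [a] under [g] consists of CDVs of [f], all equal by [cdv_uniq]. *)
have g1 v : g v = g a -> v = a.
  by rewrite ga => /eqP; rewrite gi => /andP[/eqP fv cv]; apply: (cdv_uniq fP).
have pP := elimT (properP g) gP.
have [j [k [ja ka jk]]] : exists j k, [/\ j != g a, k != g a & j != k].
  by exists (inord ((g a).+1 %% 3)), (inord ((g a).+2 %% 3));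
     case: (g a) => [[|[|[|//]]] ?]; rewrite -!val_eqE /= !inordK.
have [b bj cb] := chromatic_class_cdv j chi3 gP.
have [c ck cc] := chromatic_class_cdv k chi3 gP.
(* A CDV [x] of another class sees [a], the only vertex of its color, and a vertex of the third
   color [l], which is not [a]. *)
have nl x l : g x != g a -> cdv g x -> l != g a -> l != g x ->
    nonleaf_nbr a x.
  move=> xa cx la lx; have ax : g a != g x by rewrite eq_sym.
  have [w xw /g1 wa] := cdv_nbr chi3 gP cx ax.
  have [y xy yl] := cdv_nbr chi3 gP cx lx.
  apply: nonleaf_nbrI xy _; first by rewrite adjC -wa.
  by apply: contraNneq la => <-; rewrite yl.
exists g, b, c; split=> // [|| x]; first by rewrite bj ck.
  by split; exists g.
apply/idP/pred2P => [/andP[ax /existsP[y /andP[xy ya]]]|]; last first.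
  case=> ->; first by apply: (nl _ k); rewrite ?bj // eq_sym.
  by apply: (nl _ j); rewrite ?ck.
have cx : cdv g x.
  apply: (cdv_of_nbrs (x := a) (y := y)) => //.
  - by rewrite adjC.
  - by rewrite eq_sym pP.
  - exact: pP.
  - by apply: contraNneq ya => /esym/g1->.
have xa : g x != g a by rewrite eq_sym pP.
have gajk : [|| g x == g a, g x == j | g x == k].
  by apply: ord3_cover; rewrite // eq_sym.
case/or3P: gajk => /eqP gx; first by rewrite gx eqxx in xa.
- by left; apply: (cdv_uniq gP); rewrite ?bj.
- by right; apply: (cdv_uniq gP); rewrite ?ck.
Qed.

Lemma critical_nbr (a b : G) : critical a -> nonleaf_nbr a b -> critical b.
Proof.
move/critical_pivot=> [g [b0 [c0 [_ _ _ [cb cc] ->]]]].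
by case/pred2P=> ->.
Qed.

Lemma critical_other_nbr (a b : G) : critical a -> nonleaf_nbr a b ->
  exists2 c, c != b & nonleaf_nbr a =1 pred2 b c.
Proof.
move/critical_pivot=> [g [b0 [c0 [_ _ gbc _ nla]]]]; rewrite nla.
have bc0 : b0 != c0 by apply: contraNneq gbc => ->.
case/pred2P=> ->; first by exists c0; rewrite // eq_sym.
by exists b0 => // x; rewrite nla /= orbC.
Qed.

(** The pair given by [critical_pivot] is [b], [c] in some order, so its coloring serves for
    prescribed neighbors. *)
Lemma critical_coloring (a b c : G) :
    critical a -> b != c -> nonleaf_nbr a b -> nonleaf_nbr a c ->
  exists g : {ffun G -> 'I_3},
    [/\ proper_coloring g, forall v, g v = g a -> v = a, g b != g c &
        nonleaf_nbr a =1 pred2 b c].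
Proof.
move=> /critical_pivot[g [b0 [c0 [gP g1 gbc _ nla]]]] bc.
rewrite !nla => /pred2P[] bE /pred2P[] cE;
move: bc; rewrite bE cE ?eqxx // => _.
  by exists g.
by exists g; split=> // [|x]; rewrite 1?eq_sym // nla /= orbC.
Qed.

(* Otherwise giving the neighbour [x] the color of [a] would turn [b'] into a
   CDV with the color of the CDV [c]. *)
Lemma nbr_at_distance_two (a b c b' c' x : G) :
    critical a -> b != c -> ~~ adj b c -> adj a b -> adj a c ->
    adj b b' -> adj c c' -> b' != a -> c' != a ->
  adj b' x -> x = b \/ x = c'.
Proof.
move=> ca bc nbc ab ac bb' cc' b'a c'a b'x.
have [g [gP g1 gbc nla]] :=
  critical_coloring ca bc (nonleaf_nbrI ab bb' b'a) (nonleaf_nbrI ac cc' c'a).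
have pP := elimT (properP g) gP.
have [->|xb] := eqVneq x b; [by left | right; apply/eqP].
apply: contraT => xc'.
have gN v : v != a -> g v != g a by apply: contraNneq => /g1->.
have gab : g a != g b by apply: pP.
have gac : g a != g c by apply: pP.
(* Being adjacent to [b] and distinct from [a], [b'] is left with the third color; likewise for
   [c']. *)
have gb' : g b' = g c.
  case/or3P: (ord3_cover (g b') gab gac gbc) => /eqP // gb'.
    by rewrite (g1 _ gb') eqxx in b'a.
  by move: (pP _ _ bb'); rewrite gb' eqxx.
have gc' : g c' = g b.
  case/or3P: (ord3_cover (g c') gab gac gbc) => /eqP // gc'.
    by rewrite (g1 _ gc') eqxx in c'a.
  by move: (pP _ _ cc'); rewrite gc' eqxx.
(* Otherwise [x] is a non-leaf neighbor of [a], hence [b] or [c]; [b] is excluded, and [c] has the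
   color of [b'], which is adjacent to [x]. *)
have xa : ~~ adj x a.
  apply/negP=> xa; have : nonleaf_nbr a x.
    by apply: (nonleaf_nbrI (y := b')); rewrite // adjC.
  rewrite nla => /pred2P[] xE; first by rewrite xE eqxx in xb.
  by move: (pP _ _ b'x); rewrite gb' xE eqxx.
(* Proper because [a] is alone in its class and not adjacent to [x]. *)
pose h := [ffun v => if v == x then g a else g v].
have hN v : v != x -> h v = g v by rewrite ffunE => /negbTE->.
have hx : h x = g a by rewrite ffunE eqxx.
have ha : h a = g a by rewrite ffunE; case: ifP.
have hxN y : adj x y -> h x != h y.
  move=> xy; rewrite hx hN 1?eq_sym ?adjNeq // gN //.
  by apply: contraNneq xa => <-.
have hP : proper_coloring h.
  apply/properP=> u v uv; have [uE|ux] := eqVneq u x.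
    by rewrite uE hxN // -uE.
  have [vE|vx] := eqVneq v x; last by rewrite !hN ?pP.
  by rewrite vE eq_sym hxN // adjC -vE.
have xc : x != c.
  by apply: contraTneq (pP _ _ b'x) => ->; rewrite gb' eqxx.
have hb' : h b' = g c by rewrite hN ?adjNeq.
have hb : h b = g b by rewrite hN // eq_sym.
have hc : h c = g c by rewrite hN // eq_sym.
have hc' : h c' = g b by rewrite hN // eq_sym.
(* [b'] sees [b] and the recolored [x]; [c] sees [a] and [c'], which keeps its color because [x] is
   not [c']. *)
have cb' : cdv h b'.
  apply: (cdv_of_nbrs (x := b) (y := x)); rewrite ?hb' ?hb ?hx // 1?eq_sym //.
  by rewrite adjC.
have cc : cdv h c.
  apply: (cdv_of_nbrs (x := c') (y := a)); rewrite ?hc ?hc' ?ha // 1?eq_sym //.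
  by rewrite adjC.
have b'c : b' = c by apply: (cdv_uniq hP); rewrite ?hb' ?hc.
by move: nbc; rewrite -b'c bb'.
Qed.

Lemma triangle_or_C5 : connected G ->
  isomorphic G C5 \/ exists p q r, isomorphic G (Tgraph p q r).
Proof.
move=> Gc; have [a ca] := critical_exists.
have [g [b [c [_ _ gbc [cb cc] nla]]]] := critical_pivot ca.
have bc : b != c by apply: contraNneq gbc => ->.
have nab : nonleaf_nbr a b by rewrite nla /= eqxx.
have nac : nonleaf_nbr a c by rewrite nla /= eqxx orbT.
have ab : adj a b by case/andP: nab.
have ac : adj a c by case/andP: nac.
have ba : adj b a by rewrite adjC.
have cA : adj c a by rewrite adjC.
have nba : nonleaf_nbr b a by apply: nonleaf_nbrI ba ac _; rewrite eq_sym.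
have nca : nonleaf_nbr c a by apply: nonleaf_nbrI cA ab _.
have [b' b'a nlb] := critical_other_nbr cb nba.
have [c' c'a nlc] := critical_other_nbr cc nca.
have [adjbc|nbc] := boolP (adj b c).
  (* Each of [a], [b], [c] has exactly the other two as non-leaf neighbors, so all further neighbors
     are leaves. *)
  right; pose t (i : 'I_3) := nth a [:: a; b; c] i.
  have a_b := adjNeq ab; have a_c := adjNeq ac.
  have b'E : b' = c.
    have: nonleaf_nbr b c by apply: nonleaf_nbrI adjbc cA a_b.
    by rewrite nlb => /pred2P[] cE //; rewrite cE eqxx in a_c.
  have c'E : c' = b.
    have: nonleaf_nbr c b.
      by apply: (nonleaf_nbrI (y := a)); rewrite // adjC.
    by rewrite nlc => /pred2P[] bE //; rewrite bE eqxx in a_b.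
  apply: (@Tgraph_char G t) => //.
    by move=> [[|[|[|//]]] ?] [[|[|[|//]]] ?] //= _; rewrite /t /= // adjC.
  have tN i x : nonleaf_nbr (t i) x -> x \in codom t.
    have tin k (lt : k < 3) : nth a [:: a; b; c] k \in codom t.
      exact: (codom_f t (Ordinal lt)).
    have ta := tin 0 isT; have tb := tin 1 isT; have tc := tin 2 isT.
    case: i => [[|[|[|//]]] ?] nx.
    - by have: pred2 b c x; [rewrite -nla | case/pred2P=> ->].
    - by have: pred2 a c x; [rewrite -b'E -nlb | case/pred2P=> ->].
    - by have: pred2 a b x; [rewrite -c'E -nlc | case/pred2P=> ->].
  move=> i x y tx nx xy; apply/eqP; apply: contraNT nx => yt.
  by apply: (tN i); apply: nonleaf_nbrI tx xy yt.
left.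
have nbb' : nonleaf_nbr b b' by rewrite nlb /= eqxx orbT.
have ncc' : nonleaf_nbr c c' by rewrite nlc /= eqxx orbT.
have bb' : adj b b' by case/andP: nbb'.
have cc'A : adj c c' by case/andP: ncc'.
have b'b : adj b' b by rewrite adjC.
have c'c : adj c' c by rewrite adjC.
have ncb : ~~ adj c b by rewrite adjC.
have cb_ : c != b by rewrite eq_sym.
have Nb' x : adj b' x -> x = b \/ x = c'.
  exact: nbr_at_distance_two ca bc nbc ab ac bb' cc'A b'a c'a.
have Nc' x : adj c' x -> x = c \/ x = b'.
  exact: nbr_at_distance_two ca cb_ ncb ac ab cc'A bb' c'a b'a.
(* [b'] is not a leaf, and its neighbor other than [b] can only be [c']. *)
have b'c' : adj b' c'.
  case/andP: nbb' => _ /existsP[y /andP[b'y yb]].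
  by case: (Nb' _ b'y) => yE; rewrite -?yE // yE eqxx in yb *.
have c'b' : adj c' b' by rewrite adjC.
have b'c : b' != c by apply: contraNneq nbc => <-.
have c'b : c' != b by apply: contraNneq ncb => <-.
have nbc' : ~~ adj b c'.
  by apply/negP; rewrite adjC => /Nc'[] bE;
     [rewrite bE eqxx in bc | rewrite bE adj_irrefl in bb'].
have nb'c : ~~ adj c b'.
  by apply/negP; rewrite adjC => /Nb'[] cE;
     [rewrite cE eqxx in bc | rewrite cE adj_irrefl in cc'A].
(* Now [b'] and [c'] serve as centers: [nbr_at_distance_two] around [b'] bounds the neighbors of [a]
   and [c], around [c'] those of [b]. *)
have cb' : critical b' := critical_nbr cb nbb'.
have cc' : critical c' := critical_nbr cc ncc'.
have b_c' : b != c' by rewrite eq_sym.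
have c_b' : c != b' by rewrite eq_sym.
have a_b' : a != b' by rewrite eq_sym.
have a_c' : a != c' by rewrite eq_sym.
have Na x : adj a x -> x = b \/ x = c.
  by apply: nbr_at_distance_two cb' b_c' nbc' b'b b'c' ba c'c a_b' c_b'.
have Nc x : adj c x -> x = c' \/ x = a.
  apply: nbr_at_distance_two cb' c'b _ b'c' b'b c'c ba c_b' a_b'.
  by rewrite adjC.
have Nb x : adj b x -> x = b' \/ x = a.
  apply: nbr_at_distance_two cc' b'c _ c'b' c'c b'b cA b_c' a_c'.
  by rewrite adjC.
have nbrs (u v w : G) : adj u v -> adj u w ->
    (forall x, adj u x -> x = v \/ x = w) -> adj u =1 pred2 v w.
  by move=> uv uw Nu x; apply/idP/pred2P => [/Nu|[]->].
apply: (@C5_char G a b b' c' c) => //.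
- by rewrite /= !inE !negb_or a_b' a_c' b_c' b'c bc !adjNeq.
- exact: nbrs.
- by apply: nbrs => // x /Nb[]->; [right | left].
- exact: nbrs.
- by apply: nbrs => // x /Nc'[]->; [right | left].
- exact: nbrs.
Qed.

End OneCdvPerClass.

(** * CDVs of the exceptional graphs *)

Lemma C5_cdv_uniq (G : sgraph) k (c : {ffun G -> 'I_k}) (u v : G) :
    isomorphic G C5 -> proper_coloring c -> cdv c u -> cdv c v ->
  c u = c v -> u = v.
Proof.
move=> [f [[h fK hK] f_mono]] /properP cP cu cv cuv.
(* Indexing modulo 5 makes [n (i + 1)] and [n (i + 4)] the neighbors of [n i]. *)
pose n (i : nat) : C5 := inord (i %% 5); pose e (x : C5) := c (h x).
have nval i : n i = i %% 5 :> nat by rewrite inordK // ltn_pmod.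
have n5 i : n (i + 5) = n i by apply: val_inj; rewrite /= !nval modnDr.
have nS i : adj (n i) (n i.+1).
  by apply/orP; left; rewrite !nval -addn1 -[(i %% 5).+1]addn1 modnDml.
have nN i w : adj (n i) w -> w = n (i + 1) \/ w = n (i + 4).
  have toeq d : (w == (i %% 5 + d) %% 5 :> nat) -> w = n (i + d).
    by move=> /eqP wd; apply: val_inj; rewrite /= nval wd modnDml.
  move=> iw; suff /orP[] : (w == (i %% 5 + 1) %% 5 :> nat)
                       || (w == (i %% 5 + 4) %% 5 :> nat).
  - by move/toeq; left.
  - by move/toeq; right.
  move: iw; rewrite /= /C5_adj /= nval; have := ltn_pmod i (isT : 0 < 5).
  case: (i %% 5) => [|[|[|[|[|//]]]]] _;
  by case: {toeq} w => [[|[|[|[|[|//]]]]] ?].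
have eP x y : adj x y -> e x != e y.
  by move=> xy; apply: cP; rewrite -f_mono !hK.
have eN i x : cdv c (h (n i)) ->
    [\/ e x = e (n i), e x = e (n (i + 1)) | e x = e (n (i + 4))].
  rewrite /e => /cdvP/(_ (h x))[w wi <-].
  have: (f w == n i) || adj (n i) (f w).
    by move: wi; rewrite -f_mono hK -(inj_eq (can_inj fK)) hK.
  case/predU1P=> [<-|/nN[]<-]; rewrite fK.
  - by constructor 1.
  - by constructor 2.
  - by constructor 3.
(* The color of [i + 3] must occur around [i], which leaves only that of [i + 1]; then the color of
   [i + 4] cannot occur around [i + 2]. *)
have two i : cdv c (h (n i)) -> cdv c (h (n (i + 2))) ->
    e (n i) = e (n (i + 2)) -> False.
  move=> ci ci2 ei.
  have e34 := eP _ _ (nS (i + 3)); have e23 := eP _ _ (nS (i + 2)).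
  have e40 := eP _ _ (nS (i + 4)).
  rewrite -addnS n5 in e40; rewrite -addnS -ei in e23; rewrite -addnS in e34.
  have e31 : e (n (i + 3)) = e (n (i + 1)).
    case: (eN i (n (i + 3)) ci) => // ee; first by rewrite ee eqxx in e23.
    by rewrite ee eqxx in e34.
  case: (eN (i + 2) (n (i + 4)) ci2) => ee.
  - by rewrite ee -ei eqxx in e40.
  - by rewrite ee -addnA eqxx in e34.
  - by move: e34; rewrite ee -addnA (addnA i 1 5) n5 e31 eqxx.
have fn x : h (n (f x)) = x.
  by rewrite -[RHS]fK; congr h; apply: val_inj; rewrite /= nval modn_small.
have [d d5 vE] : exists2 d, d < 5 & f v = n (f u + d).
  (* Adding 5 keeps the truncated subtraction exact. *)
  exists ((f v + 5 - f u) %% 5); first by rewrite ltn_pmod.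
  apply: val_inj; rewrite /= nval modnDmr subnKC ?modnDr ?modn_small //.
  by rewrite (leq_trans (ltnW (ltn_ord (f u)))) ?leq_addl.
have {vE} vE : v = h (n (f u + d)) by rewrite -vE fK.
rewrite -(fn u) vE in cu cv cuv *.
(* Offsets 1 and 4 give adjacent vertices; offset 3 from [u] to [v] is offset 2 from [v] to [u]. *)
case: d d5 vE cv cuv => [|[|[|[|[|//]]]]] _ vE cv cuv.
- by rewrite addn0.
- by have := eP _ _ (nS (f u)); rewrite /e cuv addn1 eqxx.
- by case: (two (f u)).
- case: (two (f u + 3)) => //; last by rewrite -addnA n5 /e -cuv.
  by rewrite -addnA n5.
- by have := eP _ _ (nS (f u + 4)); rewrite -addnS n5 /e cuv eqxx.
Qed.

(** All [k] colors are in use, while a leaf sees at most two; so CDVs lie on the triangle, where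
    colors differ. *)
Lemma Tgraph_cdv_uniq (G : sgraph) k (c : {ffun G -> 'I_k}) (u v : G) p q r :
    isomorphic G (Tgraph p q r) -> 3 <= k -> b_coloring c ->
    cdv c u -> cdv c v ->
  c u = c v -> u = v.
Proof.
move=> [f [[h fK hK] f_mono]] k3 /andP[/properP cP /forallP cs] cu cv cuv.
have center x : cdv c x -> exists i, f x = inl i.
  move=> /cdvP cx; case fx: (f x) => [i|l]; first by exists i.
  suff: #|[set: 'I_k]| <= #|[set c x; c (h (inl (tag l)))]|.
    by rewrite cardsT card_ord cards2 => /(leq_trans k3); case: eqP.
  apply/subset_leq_card/subsetP=> j _.
  have /card_gt0P[y] := cs j; rewrite !inE => /andP[/eqP <- _].
  have [w wx <-] := cx y; case/predU1P: wx => [->|]; first by rewrite eqxx.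
  rewrite -f_mono fx; case fw: (f w) => [i|//] /= /eqP il.
  by rewrite -il -fw fK eqxx orbT.
have [[i fu] [j fv]] := (center u cu, center v cv).
have [ij|ij] := eqVneq i j; first by apply: (can_inj fK); rewrite fu fv ij.
have uv : adj u v by rewrite -f_mono fu fv.
by have := cP _ _ uv; rewrite cuv eqxx.
Qed.

Theorem theorem6p1 (G : sgraph) (G_connected : connected G)
    (G_chi3 : chromatic_number G = 3) :
  realizes_inf G two_ones <->
    ~ isomorphic G C5 /\ forall r s t : nat, ~ isomorphic G (Tgraph r s t).
Proof.
have [from_inf to_inf] := realizes_two_ones G; split.
  move=> /from_inf[k [c [u [v [cb uv cuv cu cv]]]]]; have /andP[cP _] := cb.
  split=> [iso|r s t iso].
    by case/eqP: uv; apply: C5_cdv_uniq iso cP cu cv cuv.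
  have k3 : 3 <= k.
    by rewrite -G_chi3 chromatic_le //; apply/colorableP; exists c.
  by case/eqP: uv; apply: Tgraph_cdv_uniq iso k3 cb cu cv cuv.
move=> [nC5 nT]; apply: to_inf.
have [/existsP[c /existsP[u /existsP[v]]]|none] := boolP
  [exists c : {ffun G -> 'I_3}, exists u, exists v,
    [&& proper_coloring c, u != v, c u == c v, cdv c u & cdv c v]].
  (* With chromatic number 3 every class has a CDV, so this 3-coloring is a b-coloring. *)
  case/and5P=> cP uv /eqP cuv cu cv; exists 3, c, u, v; split=> //.
  rewrite /b_coloring cP; apply/forallP=> i; apply/card_gt0P.
  have [w cw wc] := chromatic_class_cdv i G_chi3 cP.
  by exists w; rewrite inE cw eqxx.
have cdv_uniq (c : {ffun G -> 'I_3}) u v :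
    proper_coloring c -> cdv c u -> cdv c v -> c u = c v -> u = v.
  move=> cP cu cv cuv; apply/eqP; apply: contraNT none => uv.
  apply/existsP; exists c; apply/existsP; exists u; apply/existsP; exists v.
  by rewrite cP uv cuv eqxx cu cv.
have [//|[p [q [r iso]]]] := triangle_or_C5 G_chi3 cdv_uniq G_connected.
by case: (nT p q r).
Qed.
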